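(* Let $D$ be a signed digraph on $[n]$. Then \[ g(D,2)\ge \delta^0+\left(\log_2\frac{4}{3}\right)\delta^\pm-\log_2 n. \]
   Context: A signed digraph on $[n]=\{0,\dots,n-1\}$ is $D=([n],E,\lambda)$ with $E\subseteq[n]\times[n]$ (loops allowed) and $\lambda:E\to\{-1,0,1\}$. For $i\in[n]$ and $\alpha\in\{-1,0,1\}$, $N^\alpha(i)=\{j:(j,i)\in E,\lambda(j,i)=\alpha\}$, $d_i^\alpha=|N^\alpha(i)|$, and $N(i)$ is the union of the $N^\alpha(i)$. Let $\delta^0=\min_i d_i^0$ and $\delta^\pm=\min_i(d_i^{1}+d_i^{-1})$. $F(D,2)$ is the set of maps $f:\{0,1\}^n\to\{0,1\}^n$ such that each $f_i$ depends only on $x_{N(i)}$, is non-decreasing in $x_j$ when $\lambda(j,i)=1$ and non-increasing in $x_j$ when $\lambda(j,i)=-1$; $g(D,2)=\max_{f\in F(D,2)}\log_2|\mathrm{Fix}(f)|$, where $\mathrm{Fix}(f)$ is the set of fixed points of $f$.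
   Formalization: The digraph with n = 1 whose single vertex has a negative loop is excluded, because there g(D,2) = 0 while the right-hand side is log_2(4/3) > 0; n ≥ 1 is assumed. *)

(* Defs.v *)
From HB Require Import structures.
From mathcomp Require Import all_boot all_order all_algebra.
From mathcomp Require Import reals exp.

Set Implicit Arguments.
Unset Strict Implicit.
Unset Printing Implicit Defensive.

Import Order.TTheory GRing.Theory Num.Theory.
Local Open Scope ring_scope.

Record signed_digraph (n : nat) := SignedDigraph {
  arcs : {set 'I_n * 'I_n};
  label : {e : 'I_n * 'I_n | e \in arcs} -> int;
  labelP : forall e, label e \in [:: -1; 0; 1] }.

Section SignedDigraph.
Variables (n : nat) (D : signed_digraph n).

Definition in_nbr_label (a : int) (i : 'I_n) : {set 'I_n} :=
  [set j | [exists e : {e : 'I_n * 'I_n | e \in arcs D},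
             (val e == (j, i)) && (label e == a)]].

Definition in_nbr (i : 'I_n) : {set 'I_n} :=
  in_nbr_label (-1) i :|: in_nbr_label 0 i :|: in_nbr_label 1 i.

Definition in_deg_label (a : int) (i : 'I_n) : nat := #|in_nbr_label a i|.

(* The default value [n] is an upper bound of every in-degree, so for [0 < n]
   these are the minima over the vertices. *)
Definition min_deg0 : nat := \big[minn/n]_(i < n) in_deg_label 0 i.

Definition min_degS : nat :=
  \big[minn/n]_(i < n) (in_deg_label 1 i + in_deg_label (-1) i)%N.

End SignedDigraph.

Definition state (n : nat) := {ffun 'I_n -> bool}.

Section LocalFunction.
Variables (n : nat) (h : state n -> bool).

Definition depends_only_on (S : {set 'I_n}) : bool :=
  [forall x : state n, forall y : state n,
    [forall j in S, x j == y j] ==> (h x == h y)].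

Definition nondecreasing_in (j : 'I_n) : bool :=
  [forall x : state n, forall y : state n,
    [forall k, (k != j) ==> (x k == y k)] ==> (x j <= y j)%N ==>
    (h x <= h y)%N].

Definition nonincreasing_in (j : 'I_n) : bool :=
  [forall x : state n, forall y : state n,
    [forall k, (k != j) ==> (x k == y k)] ==> (x j <= y j)%N ==>
    (h y <= h x)%N].

End LocalFunction.

Section Guessing.
Variables (n : nat) (D : signed_digraph n).

Definition networks : {set {ffun state n -> state n}} :=
  [set f : {ffun state n -> state n} | [forall i : 'I_n,
    [&& depends_only_on (fun x => f x i) (in_nbr D i),
        [forall j in in_nbr_label D 1 i, nondecreasing_in (fun x => f x i) j]
      & [forall j in in_nbr_label D (-1) i,
          nonincreasing_in (fun x => f x i) j]]]].

Definition Fix (f : {ffun state n -> state n}) : {set state n} :=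
  [set x | f x == x].

End Guessing.

Definition log2 (R : realType) (x : R) : R := ln x / ln 2.

(* Constant maps belong to [networks D] and have a fixed point, so neither the
   default value 0 nor the maps without fixed points (for which [ln 0 = 0])
   affect the maximum; see [guessing_numberP]. *)
Definition guessing_number (R : realType) (n : nat) (D : signed_digraph n) : R :=
  \big[Num.max/0]_(f in networks D) log2 (#|Fix f|%:R : R).

Lemma const_networks (n : nat) (D : signed_digraph n) (c : state n) :
  [ffun=> c] \in networks D.
Proof.
rewrite inE; apply/forallP => i; apply/and3P; split.
- rewrite /depends_only_on; apply/forallP => x; apply/forallP => y.
  by rewrite !ffunE eqxx implybT.
- apply/forall_inP => j _; rewrite /nondecreasing_in.
  by apply/forallP => x; apply/forallP => y; rewrite !ffunE leqnn !implybT.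
- apply/forall_inP => j _; rewrite /nonincreasing_in.
  by apply/forallP => x; apply/forallP => y; rewrite !ffunE leqnn !implybT.
Qed.

Lemma Fix_const (n : nat) (c : state n) : c \in Fix [ffun=> c].
Proof. by rewrite inE ffunE. Qed.

Lemma log2_nat_ge0 (R : realType) (m : nat) : 0 <= log2 (m%:R : R).
Proof.
apply: divr_ge0; last by rewrite ln_ge0 ?ler1n.
by case: m => [|m]; [rewrite ln0 | rewrite ln_ge0 ?ler1n].
Qed.

Lemma guessing_numberP (R : realType) (n : nat) (D : signed_digraph n) :
  (exists2 f, f \in networks D &
     (0 < #|Fix f|)%N /\ guessing_number R D = log2 #|Fix f|%:R) /\
  (forall f, f \in networks D -> log2 #|Fix f|%:R <= guessing_number R D).
Proof.
split; last first.
  move=> f fF; rewrite /guessing_number.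
  exact: (@Order.TotalTheory.le_bigmax_cond _ _ _ 0 _ _ (fun f => log2 (#|Fix f|%:R : R))).
pose c : {ffun state n -> state n} := [ffun=> [ffun=> false]].
have cF : c \in networks D by exact: const_networks.
have c_gt0 : (0 < #|Fix c|)%N by apply/card_gt0P; exists [ffun=> false]; exact: Fix_const.
have := @eq_bigmax _ _ _ 0 c (mem (networks D))
  (fun f => log2 (#|Fix f|%:R : R)) cF (fun f _ => log2_nat_ge0 R _).
case=> f fF gE; have [f0|f_gt0] := posnP #|Fix f|; last by exists f.
exists c => //; split=> //; apply/eqP; rewrite eq_le; apply/andP; split.
  by rewrite /guessing_number gE f0 /log2 ln0 // mul0r log2_nat_ge0.
exact: (@Order.TotalTheory.le_bigmax_cond _ _ _ 0 _ _ (fun f => log2 (#|Fix f|%:R : R))).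
Qed.

(* Main.v *)
(* Call two distinct states in conflict at i if one of them is 1 at i, the other
   is 0 at i, and the first is below the second in the order on N(i) induced by
   the labels. A set of pairwise conflict-free states is fixed pointwise by some
   network of F(D,2). A random pair is in conflict at i, in either direction,
   with probability at most (2/3) p, where p = (1/2)^delta0 (3/4)^deltaS; a
   negative loop at i is what turns the constant 1/2 into 2/3. Turan's bound then
   gives a conflict-free set of size 2^n / (1 + (2/3) n p 2^n), which is at least
   1 / (n p) once n p 2^n >= 3. Otherwise n <= 2, and these cases are direct. *)
Require Import Defs.
From mathcomp Require Import all_boot all_order all_algebra.
From mathcomp Require Import reals exp.
From mathcomp Require Import zify ring lra.

Import Order.TTheory GRing.Theory Num.Theory.
Local Open Scope ring_scope.

(** * Independent sets in a finite graph *)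

(* Greedy removal of the closed neighbourhood of a vertex of minimum degree. Since
   e is reflexive, the double sum is |A| plus twice the number of edges. *)
Lemma turan (T : finType) (e : rel T) (A : {set T}) :
  reflexive e -> symmetric e ->
  exists2 I : {set T}, I \subset A &
    {in I &, forall x y, e x y -> x = y} /\
    (#|A| ^ 2 <= #|I| * \sum_(x in A) \sum_(y in A) e x y)%N.
Proof.
move=> exx esym; have [m] := ubnP #|A|.
elim: m A => // m IHm A ltAm.
have [->|/set0Pn[x0 x0A]] := eqVneq A set0.
  exists set0; rewrite ?sub0set ?cards0 //; split=> // x y; by rewrite inE.
pose deg x := (\sum_(y in A) e x y)%N.
have [v vA vmin] := @arg_minnP _ x0 (fun x => x \in A) deg x0A.
pose B := [set y in A | e v y].
have BA : B \subset A by apply/subsetP => y; rewrite inE => /andP[].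
have vB : v \in B by rewrite inE vA exx.
have degB : deg v = #|B|.
  by rewrite /deg -big_mkcondr /= sum1dep_card /B; apply: eq_card => y; rewrite !inE.
have cardA : #|A| = (#|B| + #|A :\: B|)%N.
  by rewrite (cardsD A B) (setIidPr BA) subnKC // subset_leq_card.
have B_gt0 : (0 < #|B|)%N by apply/card_gt0P; exists v.
have [|I IA [Ind bound]] := IHm (A :\: B); first by lia.
have vI : v \notin I.
  by apply: contraL vB => /(subsetP IA); rewrite inE => /andP[].
exists (v |: I).
  rewrite subUset sub1set vA; apply: subset_trans IA _; exact: subsetDl.
have nev y : y \in I -> ~~ e v y.
  by move=> /(subsetP IA); rewrite !inE => /andP[+ yA]; rewrite yA.
split.
  move=> x y /setU1P[->|xI] /setU1P[->|yI] //; last by apply: Ind.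
  - by move=> h; have := nev _ yI; rewrite h.
  - by rewrite esym => h; have := nev _ xI; rewrite h.
rewrite cardsU1 vI.
set S' := (\sum_(x in A :\: B) _)%N in bound.
(* Every vertex of [B] has degree at least [deg v = #|B|], so the rows of [B] alone contribute
   [#|B| ^ 2]. *)
have leS : (#|B| ^ 2 + S' <= \sum_(x in A) deg x)%N.
  rewrite (big_setID B) /= (setIidPr BA) leq_add //.
    rewrite -mulnn -sum_nat_const leq_sum // => x xB.
    by rewrite -degB vmin // (subsetP BA).
  rewrite leq_sum // => x _.
  by rewrite /deg [leqRHS](big_setID B) /= leq_addl.
apply: leq_trans (leq_mul (leqnn _) leS) => {leS IA}.
rewrite cardA; move: bound; clearbody S'; move: #|B| #|A :\: B| #|I| S' => k r a s bound.
(* AM-GM: [2 k r <= a k^2 + s], since [r^2 <= a s]. *)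
have amgm : (2 * k * r <= a * k ^ 2 + s)%N.
  rewrite -leq_sqr; apply: leq_trans (nat_AGM2 (a * k ^ 2) s).
  have -> : ((2 * k * r) ^ 2 = 4 * k ^ 2 * r ^ 2)%N by ring.
  have -> : (4 * (a * k ^ 2 * s) = 4 * k ^ 2 * (a * s))%N by ring.
  by rewrite leq_mul2l bound orbT.
nia.
Qed.

(** * Conflicts and the network built from a conflict-free set *)

Lemma in_nbr_label_inj {n : nat} {D : signed_digraph n} {i j : 'I_n} {a b : int} :
  j \in in_nbr_label D a i -> j \in in_nbr_label D b i -> a = b.
Proof.
rewrite !inE => /existsP[e /andP[/eqP ej /eqP <-]].
move=> /existsP[e' /andP[/eqP ej' /eqP <-]].
by congr label; apply: val_inj; rewrite ej ej'.
Qed.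

Definition nbr_le {n : nat} (D : signed_digraph n) (i : 'I_n) (x y : state n) : bool :=
  [forall j, [&& (j \in in_nbr_label D 0 i) ==> (x j == y j),
                 (j \in in_nbr_label D 1 i) ==> (x j ==> y j)
               & (j \in in_nbr_label D (-1) i) ==> (y j ==> x j)]].

Definition conflict_at {n : nat} (D : signed_digraph n) (i : 'I_n)
    (x y : state n) : bool :=
  [&& x i, ~~ y i & nbr_le D i x y].

(** Equality is included to make the relation reflexive, as [turan] requires. *)
Definition conflict {n : nat} (D : signed_digraph n) (x y : state n) : bool :=
  (x == y) || [exists i, conflict_at D i x y || conflict_at D i y x].

Lemma nbr_le_refl (n : nat) (D : signed_digraph n) (i : 'I_n) (x : state n) :
  nbr_le D i x x.
Proof. by apply/forallP => j; rewrite eqxx !implybb !implybT. Qed.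

(** Let f_i(x) = 1 exactly when some z in [I] with z_i = 1 lies below x on N(i). Moving x up in that
    order keeps the witness z, so the signs are respected. If x in [I] has x_i = 1, it is its own
    witness; if x_i = 0, a witness would be in conflict with x at i. *)
Lemma conflict_free_Fix (n : nat) (D : signed_digraph n) (I : {set state n}) :
  {in I &, forall x y, conflict D x y -> x = y} ->
  exists2 f, f \in networks D & I \subset Fix f.
Proof.
move=> Ifree.
exists [ffun x => [ffun i => [exists z in I, z i && nbr_le D i z x]]].
  rewrite inE; apply/forallP => i; apply/and3P; split.
  - apply/forallP => x; apply/forallP => y; apply/implyP => /forall_inP xy.
    rewrite !ffunE; apply/eqP/eq_existsb => z.
    congr [&& _, _ & _]; apply/eq_forallb => j.
    case jN : (j \in in_nbr D i); first by rewrite (eqP (xy _ jN)).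
    by move: jN; rewrite /in_nbr !in_setU => /norP[/norP[/negbTE-> /negbTE->] /negbTE->].
  - apply/forall_inP => j jN; apply/forallP => x; apply/forallP => y.
    apply/implyP => /forallP xy; apply/implyP => lexy; rewrite !ffunE.
    suff: [exists z in I, z i && nbr_le D i z x] ->
          [exists z in I, z i && nbr_le D i z y].
      by case: [exists _ in _, _] => // ->.
    move=> /exists_inP[z zI /andP[zi /forallP zx]].
    apply/exists_inP; exists z => //; rewrite zi; apply/forallP => k.
    have /and3P[z0 z1 zm] := zx k.
    have [kj|kj] := eqVneq k j; last first.
      by have := xy k; rewrite kj => /eqP <-; rewrite z0 z1.
    subst k; rewrite jN /= in z1 *.
    have /negbTE-> : j \notin in_nbr_label D 0 i.
      by apply/negP => /(in_nbr_label_inj jN).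
    have /negbTE-> : j \notin in_nbr_label D (-1) i.
      by apply/negP => /(in_nbr_label_inj jN).
    by rewrite andbT /=; move: z1 lexy; case: (z j) (x j) (y j) => [] [] [].
  - apply/forall_inP => j jN; apply/forallP => x; apply/forallP => y.
    apply/implyP => /forallP xy; apply/implyP => lexy; rewrite !ffunE.
    suff: [exists z in I, z i && nbr_le D i z y] ->
          [exists z in I, z i && nbr_le D i z x].
      by case: [exists _ in _, _] => // ->.
    move=> /exists_inP[z zI /andP[zi /forallP zy]].
    apply/exists_inP; exists z => //; rewrite zi; apply/forallP => k.
    have /and3P[z0 z1 zm] := zy k.
    have [kj|kj] := eqVneq k j; last first.
      by have := xy k; rewrite kj => /eqP ->; rewrite z0 z1.
    subst k; rewrite jN /= in zm *.
    have /negbTE-> : j \notin in_nbr_label D 0 i.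
      by apply/negP => /(in_nbr_label_inj jN).
    have /negbTE-> : j \notin in_nbr_label D 1 i.
      by apply/negP => /(in_nbr_label_inj jN).
    by move: zm lexy; case: (z j) (x j) (y j) => [] [] [].
apply/subsetP => x xI; rewrite inE ffunE; apply/eqP/ffunP => i; rewrite ffunE.
case xi : (x i).
  by apply/exists_inP; exists x => //; rewrite xi nbr_le_refl.
apply/negbTE/negP => /exists_inP[z zI /andP[zi zx]].
have zxE : z = x.
  apply: Ifree => //; apply/orP; right; apply/existsP; exists i.
  by rewrite /conflict_at zi xi zx.
by rewrite zxE xi in zi.
Qed.

(** * Counting conflicts *)

Lemma card_bool2 (P : pred (bool * bool)) :
  #|P| = (P (true, true) + P (true, false) + (P (false, true) + P (false, false)))%N.
Proof.
rewrite -sum1_card big_mkcond /=.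
rewrite (eq_bigr (fun p => nat_of_bool (P (p.1, p.2)))); last first.
  by move=> [a b] _; rewrite unfold_in /=; case: (P _).
by rewrite -(pair_bigA _ (fun a b => nat_of_bool (P (a, b)))) /= big_bool !big_bool.
Qed.

(** The constraints on a pair of states act coordinate by coordinate. Of the 4 values of (x_j, y_j),
    label 0 allows 2 and labels 1 and -1 allow 3, whence the factors 1/2 and 3/4. *)
Lemma sum_conflict_at (R : realType) (n : nat) (D : signed_digraph n) (i : 'I_n) :
  i \notin in_nbr_label D 0 i -> i \notin in_nbr_label D 1 i ->
  (3 * \sum_x \sum_y conflict_at D i x y)%:R <=
    4 ^+ n * (1 / 2) ^+ in_deg_label D 0 i *
    (3 / 4) ^+ (in_deg_label D 1 i + in_deg_label D (-1) i) :> R.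
Proof.
move=> iN0 iN1.
pose F (j : 'I_n) : pred (bool * bool) := fun p =>
  [&& (j == i) ==> (p.1 && ~~ p.2),
      (j \in in_nbr_label D 0 i) ==> (p.1 == p.2),
      (j \in in_nbr_label D 1 i) ==> (p.1 ==> p.2)
    & (j \in in_nbr_label D (-1) i) ==> (p.2 ==> p.1)].
(* A pair of states in conflict at i is a choice of (x j, y j) in F j for each j. *)
have le_family : (\sum_x \sum_y conflict_at D i x y <= \prod_j #|F j|)%N.
  rewrite pair_bigA /= -big_mkcond /= sum1_card.
  pose zipf (p : state n * state n) := [ffun j => (p.1 j, p.2 j)].
  have zipf_inj : injective zipf.
    move=> [x y] [x' y'] /ffunP eqz; congr (_, _); apply/ffunP => j;
      by have := eqz j; rewrite !ffunE => -[].
  rewrite -(card_imset _ zipf_inj).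
  have -> : (\prod_j #|F j| = #|family F|)%N by rewrite card_family foldrE big_image.
  apply/subset_leq_card/subsetP => _ /imsetP[[x y] + ->].
  rewrite unfold_in /= => /and3P[xi yi /forallP xy].
  apply/familyP => j; rewrite ffunE unfold_in /= xy andbT.
  by apply/implyP => /eqP ->; rewrite xi.
pose w (j : 'I_n) : R := 4 * (if j \in in_nbr_label D 0 i then 1 / 2 else 1) *
  ((if j \in in_nbr_label D 1 i then 3 / 4 else 1) *
   (if j \in in_nbr_label D (-1) i then 3 / 4 else 1)).
have prodw : \prod_j w j = 4 ^+ n * (1 / 2) ^+ in_deg_label D 0 i *
    (3 / 4) ^+ (in_deg_label D 1 i + in_deg_label D (-1) i).
  by rewrite !big_split /= -!big_mkcond /= !prodr_const card_ord exprD.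
rewrite -prodw {prodw} (bigD1 i) //=.
apply: (@le_trans _ _ (3 * \prod_j (#|F j|)%:R)).
  by rewrite natrM -natr_prod ler_wpM2l // ler_nat.
rewrite {le_family} (bigD1 i) //= mulrA; apply: ler_pM.
- by rewrite mulr_ge0.
- exact: prodr_ge0.
(* At i only the pair (1, 0) is allowed, while [w i] is 3 under a negative loop and 4 otherwise:
   this is the origin of the factor 3. *)
- rewrite /w (negbTE iN0) (negbTE iN1) card_bool2 /F /= eqxx.
  rewrite (negbTE iN0) (negbTE iN1) /=.
  by case: (i \in in_nbr_label D (-1) i) => /=; clear; lra.
- apply: ler_prod => j ji; rewrite ler0n /= /w card_bool2 /F /= (negbTE ji) /=.
  have inj := fun a b => @in_nbr_label_inj n D i j a b.
  case j0 : (j \in in_nbr_label D 0 i) => /=.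
    have /negbTE-> : j \notin in_nbr_label D 1 i by apply/negP => /(inj _ _ j0).
    have /negbTE-> /= : j \notin in_nbr_label D (-1) i by apply/negP => /(inj _ _ j0).
    by clear; lra.
  case j1 : (j \in in_nbr_label D 1 i) => /=.
    have /negbTE-> /= : j \notin in_nbr_label D (-1) i by apply/negP => /(inj _ _ j1).
    by clear; lra.
  by case: (j \in in_nbr_label D (-1) i) => /=; clear; lra.
Qed.

(** Union bound: the diagonal gives [2 ^ n], and swapping the two states shows that both directions
    of conflict have the same count. *)
Lemma sum_conflict (n : nat) (D : signed_digraph n) :
  (\sum_x \sum_y conflict D x y <=
     2 ^ n + 2 * \sum_i \sum_x \sum_y conflict_at D i x y)%N.
Proof.
have le_xy (x y : state n) : (conflict D x y <=
    (x == y) + \sum_i (conflict_at D i x y + conflict_at D i y x))%N.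
  rewrite /conflict; case: eqP => //= _.
  case: existsP => //= -[i ci]; rewrite (bigD1 i) //=.
  by move: ci; case: conflict_at; case: conflict_at.
apply: (@leq_trans (\sum_(x : state n) \sum_(y : state n)
    ((x == y) + \sum_i (conflict_at D i x y + conflict_at D i y x))%N)%N).
  by apply: leq_sum => x _; apply: leq_sum.
rewrite pair_bigA /= big_split /= leq_add //.
  rewrite -(pair_bigA _ (fun x y => nat_of_bool (x == y))) /=.
  have -> : (2 ^ n = \sum_(x : state n) 1)%N.
    by rewrite sum_nat_const muln1 card_ffun card_bool card_ord.
  apply: leq_sum => x _; rewrite (bigD1 x) //= eqxx big1 // => y.
  by rewrite eq_sym => /negbTE->.
rewrite exchange_big /= big_distrr leq_sum //= => i _.
rewrite big_split /= mul2n -addnn.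
rewrite -(pair_bigA _ (fun x y => nat_of_bool (conflict_at D i x y))) /=.
rewrite -(pair_bigA _ (fun x y => nat_of_bool (conflict_at D i y x))) /=.
by rewrite leq_add2l exchange_big.
Qed.

(** * Degree bounds, choice of the network and logarithms *)

Lemma bigminn_le (I : finType) (m : nat) (F : I -> nat) (i : I) :
  (\big[minn/m]_j F j <= F i)%N.
Proof.
have: i \in index_enum I by rewrite mem_index_enum.
elim: (index_enum I) => // j r IHr; rewrite inE big_cons.
by move=> /predU1P[->|/IHr]; [exact: geq_minl | apply: leq_trans; exact: geq_minr].
Qed.

Lemma leq_in_deg (n : nat) (D : signed_digraph n) (i : 'I_n) :
  (in_deg_label D 0 i + (in_deg_label D 1 i + in_deg_label D (-1) i) <= n)%N.
Proof.
rewrite /in_deg_label.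
have disj (a b : int) : a != b -> [disjoint in_nbr_label D a i & in_nbr_label D b i].
  move=> ab; apply/pred0P => j /=; apply/negP => /andP[ja jb].
  by rewrite (in_nbr_label_inj ja jb) eqxx in ab.
have dU (A B : {set 'I_n}) : [disjoint A & B] -> (#|A| + #|B| = #|A :|: B|)%N.
  by move=> dAB; rewrite cardsU disjoint_setI0 // cards0 subn0.
rewrite (dU _ _ (disj 1 (-1) isT)) dU.
  by rewrite -[leqRHS](card_ord n) max_card.
by rewrite -setI_eq0 setIUr !disjoint_setI0 ?setU0 ?disj.
Qed.

(** This is the theorem before taking logarithms. *)
Lemma exists_network (R : realType) (n : nat) (D : signed_digraph n) :
  (0 < n)%N -> ~ (n = 1%N /\ exists i : 'I_n, i \in in_nbr_label D (-1) i) ->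
  exists2 f, f \in networks D &
    1 <= (#|Fix f|%:R : R) *
      (n%:R * ((1 / 2) ^+ min_deg0 D * (3 / 4) ^+ min_degS D)).
Proof.
move=> n_gt0 nloop; set d0 := min_deg0 D; set dS := min_degS D.
have ge_d0 i : (d0 <= in_deg_label D 0 i)%N by exact: bigminn_le.
have ge_dS i : (dS <= in_deg_label D 1 i + in_deg_label D (-1) i)%N.
  exact: (@bigminn_le _ n (fun i => in_deg_label D 1 i + in_deg_label D (-1) i)%N i).
have led : (d0 + dS <= n)%N.
  exact: leq_trans (leq_add (ge_d0 (Ordinal n_gt0)) (ge_dS _)) (leq_in_deg _ _ _).
set p : R := (1 / 2) ^+ d0 * (3 / 4) ^+ dS.
have p_gt0 : 0 < p by rewrite mulr_gt0 // exprn_gt0 //; clear; lra.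
(* This form shows that [2 ^+ n * p] is at least 1, and later settles the case n = 2. *)
have pE : 2 ^+ n * p = 2 ^+ (n - (d0 + dS)) * (3 / 2) ^+ dS.
  have h0 : (2 : R) ^+ d0 * (1 / 2) ^+ d0 = 1.
    by rewrite -exprMn (_ : 2 * (1 / 2) = 1) ?expr1n //; clear; lra.
  have hS : (2 : R) ^+ dS * (3 / 4) ^+ dS = (3 / 2) ^+ dS.
    by rewrite -exprMn; congr (_ ^+ _); clear; lra.
  rewrite /p -{1}(subnK led) !exprD -mulrA; congr (_ * _).
  by rewrite mulrACA h0 hS mul1r.
have pow2_ge1 k : 1 <= (2 : R) ^+ k by rewrite exprn_ege1 // ler1n.
have pow32_ge1 k : 1 <= (3 / 2 : R) ^+ k by rewrite exprn_ege1 //; clear; lra.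
have mp_ge1 : 1 <= 2 ^+ n * p by rewrite pE mulr_ege1.
have nR_ge1 : 1 <= (n%:R : R) by rewrite ler1n.
have exx : reflexive (conflict D) by move=> x; rewrite /conflict eqxx.
have esym : symmetric (conflict D).
  move=> x y; rewrite /conflict eq_sym; congr (_ || _).
  by apply: eq_existsb => i; rewrite orbC.
have [I _ [Ifree]] := @turan _ (conflict D) [set: state n] exx esym.
rewrite cardsT card_ffun card_bool card_ord => turanI.
have [f fD If] := conflict_free_Fix _ _ _ Ifree.
exists f => //; apply: (@le_trans _ _ (#|I|%:R * (n%:R * p))); last first.
  by rewrite ler_wpM2r ?ler_nat ?subset_leq_card // mulr_ge0 // ltW.
set C := (\sum_i \sum_x \sum_y conflict_at D i x y)%N.
have boundI : (2 ^ n * 2 ^ n <= #|I| * (2 ^ n + 2 * C))%N.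
  rewrite mulnn; apply: leq_trans turanI _; rewrite leq_mul2l; apply/orP; right.
  apply: leq_trans (sum_conflict _ D); rewrite big_mkcond /=.
  by apply: leq_sum => x _; rewrite inE big_mkcond /=; apply: leq_sum => y _; rewrite inE.
(* A loop labelled 0 or 1 at i forces x_i <= y_i, against x_i = 1 and y_i = 0. *)
have C0 i : (i \in in_nbr_label D 0 i) || (i \in in_nbr_label D 1 i) ->
    (\sum_x \sum_y conflict_at D i x y = 0)%N.
  move=> iN; rewrite big1 // => x _; rewrite big1 // => y _; apply/eqP.
  rewrite eqb0; apply/negP => /and3P[xi yi /forallP/(_ i)].
  by move: iN; rewrite xi (negbTE yi); do 2!case: (_ \in _).
have [/forallP/= allN|/forallPn/= [i]] :=
    boolP [forall i, (i \in in_nbr_label D 0 i) || (i \in in_nbr_label D 1 i)].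
  have CE : C = 0%N by apply: big1 => i _; apply: C0.
  have geI : (2 ^ n <= #|I|)%N.
    by move: boundI; rewrite CE muln0 addn0 leq_pmul2r // expn_gt0.
  apply: (@le_trans _ _ (n%:R * (2 ^+ n * p))); first by rewrite mulr_ege1.
  rewrite mulrCA; apply: ler_wpM2r; first by rewrite mulr_ge0 // ltW.
  by rewrite -natrX ler_nat.
rewrite negb_or => /andP[iN0 iN1].
have C_le : 3 * C%:R <= n%:R * (4 ^+ n * p).
  rewrite -natrM big_distrr /= natr_sum.
  rewrite (_ : n%:R * _ = \sum_(i < n) 4 ^+ n * p); last first.
    by rewrite sumr_const card_ord mulr_natl.
  apply: ler_sum => j _.
  have [jN|] := boolP ((j \in in_nbr_label D 0 j) || (j \in in_nbr_label D 1 j)).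
    by rewrite C0 // muln0 mulr_ge0 ?exprn_ge0 // ltW.
  rewrite negb_or => /andP[jN0 jN1].
  apply: le_trans (sum_conflict_at R _ _ _ jN0 jN1) _.
  rewrite -mulrA ler_wpM2l ?exprn_ge0 //.
  by apply: ler_pM; rewrite ?exprn_ge0 ?ler_wiXn2l //; clear; lra.
have I_gt0 : (0 < #|I|)%N.
  rewrite lt0n; apply/eqP => I0; move: boundI.
  by rewrite I0 mul0n leqn0 muln_eq0 expn_eq0.
(* Write m = 2^n, q = n p, a = [#|I|], c = [C]. Then m^2 <= a (m + 2c) and 3c <= m^2 q; if m q >= 3,
   also 3m <= m^2 q, so m + 2c <= m^2 q and 1 <= a q. *)
have [np_ge3|np_lt3] := leP 3 (n%:R * (2 ^+ n * p)).
  have boundR : 2 ^+ n * 2 ^+ n <= #|I|%:R * (2 ^+ n + 2 * C%:R) :> R.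
    by rewrite -natrX -!natrM -natrD -natrM ler_nat.
  move: C_le; rewrite (_ : 4 = 2 * 2) ?exprMn; last by ring.
  have : 1 <= (#|I|%:R : R) by rewrite ler1n.
  move: boundR np_ge3 (pow2_ge1 n).
  rewrite [_ * (_ * p)]mulrCA [_ * (_ * _ * p)]mulrCA.
  move: (2 ^+ n) (#|I|%:R) (n%:R * p) (C%:R) => m a q c bound mq_ge3 m_ge1 a_ge1 c_le.
  clear - bound mq_ge3 m_ge1 a_ge1 c_le.
  have m_gt0 : 0 < m by lra.
  have le_mmq : m * 3 <= m * (m * q) by rewrite ler_pM2l.
  have : a * (m + 2 * c) <= a * (m * (m * q)) by apply: ler_wpM2l; lra.
  move=> /(le_trans bound); rewrite mulrCA ler_pM2l // mulrCA.
  by rewrite -{1}[m]mulr1 ler_pM2l.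
have n_le2 : (n <= 2)%N.
  rewrite -ltnS -(ltr_nat R); apply: le_lt_trans np_lt3.
  by rewrite ler_peMr // (le_trans ler01).
(* If n = 1, the vertex i has no loop at all, so both degrees vanish and p = 1. *)
have [n1|n2] : n = 1%N \/ n = 2%N by move: n_gt0 n_le2; clear; lia.
  have none j : j = i by apply: ord_inj; move: (ltn_ord i) (ltn_ord j) n1; clear; lia.
  have empty a : i \notin in_nbr_label D a i -> in_deg_label D a i = 0%N.
    move=> iNa; apply: eq_card0 => j; rewrite (none j); exact: negbTE.
  have iNm : i \notin in_nbr_label D (-1) i.
    by apply/negP => iNm; apply: nloop; split=> //; exists i.
  have := ge_dS i; rewrite !empty // addn0 leqn0 => /eqP dS0.
  have := ge_d0 i; rewrite !empty // leqn0 => /eqP d00.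
  by rewrite /p dS0 d00 !expr0 !mulr1 mulr_ege1 // ler1n.
(* For n = 2, a positive [dS] would make this product at least 3/2, and then [d0 < n] would make it
   at least 2. Hence [d0 = n], and i has a loop labelled 0, a contradiction. *)
have mp_lt : 2 ^+ (n - (d0 + dS)) * (3 / 2) ^+ dS < 3 / 2 :> R.
  move: np_lt3; rewrite -pE [in n%:R]n2; move: (_ * p) => mp; clear; lra.
have dS0 : dS = 0%N.
  apply/eqP; rewrite -leqn0 leqNgt; apply/negP => dS_gt0.
  move: mp_lt; rewrite ltNge => /negP; apply.
  apply: (@le_trans _ _ ((3 / 2) ^+ dS)).
    by rewrite -{1}[3 / 2]expr1 ler_weXn2l //; clear; lra.
  by rewrite ler_peMl // (le_trans ler01).
have d0n : d0 = n.
  apply/eqP; rewrite eqn_leq (leq_trans _ led) ?leq_addr //= -subn_eq0.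
  rewrite -leqn0 leqNgt; apply/negP => gt0.
  move: mp_lt; rewrite dS0 addn0 expr0 mulr1 ltNge => /negP; apply.
  apply: (@le_trans _ _ (2 ^+ 1)); first by rewrite expr1; clear; lra.
  by rewrite ler_weXn2l // ler1n.
have N0T : in_nbr_label D 0 i = [set: 'I_n].
  by apply/eqP; rewrite eqEcard subsetT cardsT card_ord -{1}d0n; exact: ge_d0.
by rewrite N0T inE in iN0.
Qed.

(* MathComp-Analysis world *)
(* For n = 1 and a single negative loop the inequality is false: g = 0 but the
   right-hand side is log2 (4/3); this is the only digraph excluded. *)
Theorem theorem2 (R : realType) (n : nat) (D : signed_digraph n)
  (n_gt0 : (0 < n)%N)
  (not_single_negative_loop :
     ~ (n = 1%N /\ exists i : 'I_n, i \in in_nbr_label D (-1) i)) :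
  guessing_number R D >=
    (min_deg0 D)%:R + log2 (4 / 3 : R) * (min_degS D)%:R - log2 (n%:R : R).
Proof.
have [f fD] := exists_network R n D n_gt0 not_single_negative_loop.
move: (min_deg0 D) (min_degS D) => d0 dS bound.
apply: le_trans ((guessing_numberP R D).2 f fD).
have ln2_gt0 : 0 < ln (2 : R) by rewrite ln_gt0 // ltr1n.
have lnhalf : ln (1 / 2 : R) = - ln 2 by rewrite div1r lnV // posrE.
have ln34 : ln (3 / 4 : R) = - ln (4 / 3) by rewrite -lnV ?invf_div // posrE; clear; lra.
have half_gt0 : 0 < (1 / 2 : R) by clear; lra.
have r34_gt0 : 0 < (3 / 4 : R) by clear; lra.
have n_pos : 0 < (n%:R : R) by rewrite ltr0n.
(* [lnM] needs positive factors; an empty [Fix f] would turn [bound] into 1 <= 0. *)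
have F_pos : 0 < (#|Fix f|%:R : R).
  rewrite lt0r ler0n andbT; apply: contraTneq bound => ->.
  by rewrite mul0r -ltNge ltr01.
have := ln_ge0 bound.
rewrite !lnM ?posrE ?mulr_gt0 ?exprn_gt0 // !lnXn // lnhalf ln34 => ln_bound.
rewrite /log2 ler_pdivlMr // mulrBl mulrDl mulrAC !divfK ?gt_eqF //.
by move: ln_bound; rewrite -[_ *+ d0]mulr_natr -[_ *+ dS]mulr_natr; lra.
Qed.
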